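(* Fix an integer $b\ge 2$ and let $B=\{b^i : i\in\mathbb{N}\}$. For every countable ordinal $\alpha$ there is a real number $x$ with $x\ast B\succeq\alpha$. There is no real number $x$ such that $x\ast B$ is well-ordered and $\omega\preceq x\ast B\prec\omega^2$.
   Context: For a real number $x$ and a set $S\subseteq\mathbb{N}$, $x\ast S := \{xs \bmod 1 : s\in S\}\subseteq[0,1)$, ordered as a subset of the reals. Order types (in particular ordinals) are compared with $\preceq,\prec,\succeq$: $\beta\preceq\gamma$ means an ordered set of type $\beta$ order-embeds into one of type $\gamma$ (for ordinals this is the usual $\le$), and $\prec$ is the strict version. *)

(* Defs.v *)
From HB Require Import structures.
From mathcomp Require Import all_boot all_order all_algebra.
From mathcomp Require Import all_classical all_reals.
Set Implicit Arguments.
Unset Strict Implicit.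
Unset Printing Implicit Defensive.
Import Order.TTheory GRing.Theory Num.Theory.
Local Open Scope classical_set_scope.
Local Open Scope ring_scope.

(* An ordinal is represented by a well-ordered [orderType], with [nat] for
   omega and [nat *l nat] (first component dominant) for omega ^ 2. *)

(* A set [A : set T] used as a type unfolds to [{x : T | x \in A}]; this
   instance gives it the order induced by [T]. *)
HB.instance Definition _ (d : Order.disp_t) (T : orderType d) (P : pred T) :=
  [SubChoice_isSubOrder of {x : T | P x} by <: with d].

Definition otype_le (d d' : Order.disp_t) (T : orderType d) (T' : orderType d')
  : Prop := exists f : T -> T', {mono f : x y / (x <= y)%O}.

(* For ordinals this is the usual strict order; bi-embeddable order types that
   are not isomorphic count as equivalent. *)
Definition otype_lt (d d' : Order.disp_t) (T : orderType d) (T' : orderType d')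
  : Prop := otype_le T T' /\ ~ otype_le T' T.

Definition mul_mod1 (R : realType) (x : R) (S : set nat) : set R :=
  [set x * s%:R - (Num.floor (x * s%:R))%:~R | s in S].

Definition powers (b : nat) : set nat := range (fun i : nat => (b ^ i)%N).

(* Main.v *)
(* First part: there is a number [x] in whose base-[b] expansion every finite
   word occurs, so the orbit [x * B] is dense in [0, 1), and a dense set contains
   every countable order type.
   Second part: multiplication by [b] modulo 1 is expanding.  If [x * B] is
   well-ordered and does not contain [omega ^ 2], then it has finitely many
   accumulation points, all approached from below only.  So all but finitely many
   points of the orbit lie just below one of finitely many reals, and the
   distance to it is multiplied by [b] at each step, hence unbounded: the orbit
   must be finite. *)
Require Import Defs.
From mathcomp Require Import all_boot all_order all_algebra.
From mathcomp Require Import all_classical all_reals wochoice.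
From mathcomp Require Import ring lra.
Set Implicit Arguments.
Unset Strict Implicit.
Unset Printing Implicit Defensive.
Import Order.TTheory GRing.Theory Num.Theory.
Local Open Scope classical_set_scope.
Local Open Scope ring_scope.

Lemma otype_le_set (R : realType) (A : set R) (d : Order.disp_t)
    (T : orderType d) (g : T -> R) :
  (forall t, A (g t)) -> {homo g : s t / (s < t)%O >-> s < t} ->
  otype_le T A.
Proof.
move=> Ag g_mono; exists (fun t => exist _ (g t) (mem_set (Ag t)) : A).
exact: (le_mono g_mono).
Qed.

(** * Binary weights of sets of naturals *)

Definition weight_sum (R : realType) (D : set nat) (N : nat) : R :=
  \sum_(i < N) (if nat_of_ord i \in D then 2^-1 ^+ i.+1 else 0).

(** The real in [0, 1] whose binary digits after the point are the indicator of [D]. *)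
Definition weight (R : realType) (D : set nat) : R :=
  sup (range (weight_sum R D)).

Section Weight.
Variable R : realType.
Implicit Type D E : set nat.

Lemma weight_sum_le1 D N : weight_sum R D N <= 1.
Proof.
(* The bound 1 alone is not inductive; the remaining geometric tail has to be kept. *)
have : weight_sum R D N <= 1 - 2^-1 ^+ N; last first.
  by move=> /le_trans; apply; rewrite gerBl exprn_ge0// invr_ge0.
elim: N => [|N IH]; first by rewrite /weight_sum big_ord0 expr0 subrr.
rewrite /weight_sum big_ord_recr /= -/(weight_sum R D N).
have h : 0 < 2^-1 ^+ N :> R by rewrite exprn_gt0// invr_gt0.
rewrite exprS; move: IH h.
by set u := 2^-1 ^+ N => IH h; case: ifP => _; lra.
Qed.

Lemma weight_sum_nd D N M : (N <= M)%N -> weight_sum R D N <= weight_sum R D M.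
Proof.
move=> /subnKC <-; elim: (M - N)%N => [|k IH]; first by rewrite addn0.
rewrite (le_trans IH)// addnS /weight_sum big_ord_recr /= lerDl.
by case: ifP => // _; rewrite exprn_ge0// invr_ge0.
Qed.

Lemma weight_sum_sub D E k N : D `<=` E -> E k -> ~ D k -> (k < N)%N ->
  weight_sum R D N + 2^-1 ^+ k.+1 <= weight_sum R E N.
Proof.
move=> DE Ek nDk kN.
rewrite /weight_sum (bigD1 (Ordinal kN))//= [leRHS](bigD1 (Ordinal kN))//=.
rewrite (mem_set Ek) memNset// add0r [leLHS]addrC lerD2l.
apply: ler_sum => i _; have [/set_mem/DE/mem_set->//|_] := boolP (_ \in D).
by case: ifP => // _; rewrite exprn_ge0// invr_ge0.
Qed.

Lemma has_sup_weight D : has_sup (range (weight_sum R D)).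
Proof.
split; first by exists (weight_sum R D 0), 0%N.
by exists 1 => _ [N _ <-]; exact: weight_sum_le1.
Qed.

Lemma weight_sum_le D N : weight_sum R D N <= weight R D.
Proof. by apply: (ub_le_sup (has_sup_weight D).2); exists N. Qed.

Lemma weight_ge0 D : 0 <= weight R D.
Proof. by have := weight_sum_le D 0; rewrite /weight_sum big_ord0. Qed.

Lemma weight_le1 D : weight R D <= 1.
Proof.
apply: ge_sup; first exact: (has_sup_weight D).1.
by move=> _ [N _ <-]; exact: weight_sum_le1.
Qed.

Lemma weight_sub D E k : D `<=` E -> E k -> ~ D k ->
  weight R D + 2^-1 ^+ k.+1 <= weight R E.
Proof.
move=> DE Ek nDk; rewrite -lerBrDr; apply: ge_sup.
  exact: (has_sup_weight D).1.
move=> _ [N _ <-]; rewrite lerBrDr.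
(* The partial sum is lengthened beyond [k], so that it contains the extra term. *)
apply: le_trans (weight_sum_le E (N + k.+1)).
apply: le_trans (weight_sum_sub DE Ek nDk (ltn_addl N (ltnSn k))).
by rewrite lerD2r weight_sum_nd// leq_addr.
Qed.

End Weight.

(* Assign to [t] the weight of the set of (codes of) its predecessors: the gap
   between the weights of [s] and [t] for [s < t] is at least the weight of [s]
   itself, so each element of [T] gets a whole interval to choose its image
   from, with no recursion. *)
Lemma countable_otype_le_dense (R : realType) (A : set R) (d : Order.disp_t)
    (T : orderType d) :
  countable [set: T] ->
  (forall u v : R, 0 <= u -> u < v -> v <= 1 -> exists2 a, A a & u < a < v) ->
  otype_le T A.
Proof.
move=> /countable_injP[n /in2TT n_inj] dense_A.
pose D t := [set n s | s in [set s | (s < t)%O]].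
pose w t : R := 2^-1 ^+ (n t).+1.
have w_gt0 t : 0 < w t by rewrite exprn_gt0// invr_gt0.
have nD t : ~ D t (n t) by case=> s /= + /n_inj st; rewrite st ltxx.
have /choice[g gP] t :
    exists a, A a /\ weight R (D t) < a < weight R (D t) + w t.
  have [||a Aa ha] := dense_A _ (weight R (D t) + w t) (weight_ge0 R (D t)).
  - by rewrite ltrDl.
  (* Comparison with [setT], of weight at most 1, keeps the interval of [t] inside [0, 1]. *)
  - exact: le_trans (weight_sub R (@subsetT _ _) I (nD t)) (weight_le1 R setT).
  - by exists a.
apply: (otype_le_set (g := g)) => [t|s t st]; first by have [] := gP t.
have [_ /andP[_ gs]] := gP s; have [_ /andP[gt _]] := gP t.
apply: (lt_trans gs); apply: le_lt_trans gt; apply: weight_sub.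
- by move=> _ [r /= rs <-]; exists r => //=; exact: lt_trans st.
- by exists s.
- exact: nD.
Qed.

(** * A number whose base-[b] expansion contains every word *)

Section RichNumber.
Variables (R : realType) (b : nat).
Hypothesis b_gt1 : (1 < b)%N.

(* [rich_prefix n = (N, p)]: the first [N] base-[b] digits of the rich number,
   read as the integer [p]; step [n] appends the word of length [l] and value
   [a] modulo [b ^ l], where [n] codes [(l, a)]. *)
Fixpoint rich_prefix (n : nat) : nat * nat :=
  if n is n'.+1 then
    let: (N, p) := rich_prefix n' in
    let: (l, a) := odflt (0, 0)%N (unpickle n') in
    (N + l, p * b ^ l + a %% b ^ l)%N
  else (0, 0)%N.

(** [lo n] and [hi n] are the ends of the cell of reals whose expansion starts with the [n]-th
    prefix. The cells are nested, so the supremum of the left ends lies in all of them. *)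
Let lo n : R := (rich_prefix n).2%:R / b%:R ^+ (rich_prefix n).1.
Let hi n : R := ((rich_prefix n).2 + 1)%:R / b%:R ^+ (rich_prefix n).1.

Definition rich_number : R := sup (range lo).

Let bX_gt0 k : 0 < b%:R ^+ k :> R.
Proof. by rewrite exprn_gt0// ltr0n (ltn_trans _ b_gt1). Qed.

Let lo_hi_step n : lo n <= lo n.+1 /\ hi n.+1 <= hi n.
Proof.
rewrite /lo /hi /=; case: (rich_prefix n) => N p /=.
case: (odflt _ _) => l a /=.
have am : (a %% b ^ l < b ^ l)%N by rewrite ltn_mod expn_gt0 (ltn_trans _ b_gt1).
split.
  rewrite ler_pdivlMr// exprD mulrA divfK ?gt_eqF// -natrX -natrM ler_nat.
  exact: leq_addr.
rewrite ler_pdivrMr// exprD mulrA divfK ?gt_eqF//.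
by rewrite -natrX -natrM ler_nat -addnA mulnDl mul1n leq_add2l addn1.
Qed.

Let lo_nd : {homo lo : n m / (n <= m)%N >-> n <= m}.
Proof.
apply: homo_leq => [//|? ? ?|n]; first exact: le_trans.
exact: (lo_hi_step n).1.
Qed.

Let hi_ni : {homo hi : n m / (n <= m)%N >-> n >= m}.
Proof.
apply: (@homo_leq _ _ (fun x y => x >= y)) => [//|x y z xy yz|n].
  exact: le_trans yz xy.
exact: (lo_hi_step n).2.
Qed.

Let lo_le_hi n m : lo n <= hi m.
Proof.
have lh k : lo k <= hi k by rewrite ler_pM2r ?invr_gt0// ler_nat leq_addr.
have /lo_nd/le_trans := leq_maxl n m; apply.
by apply: le_trans (lh _) _; apply: hi_ni; exact: leq_maxr.
Qed.

Let rich_number_itv n : lo n <= rich_number <= hi n.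
Proof.
apply/andP; split.
  by apply: ub_le_sup; [exists (hi 0) => _ [m _ <-]; exact: lo_le_hi|exists n].
apply: ge_sup; first by exists (lo 0), 0%N.
by move=> _ [m _ <-]; exact: lo_le_hi.
Qed.

(** Step [pickle (l, a)] of the construction appends this very word; shifting by the [i] digits
    before it, which form the integer [k], brings it just after the point. The cell is closed, so
    [k] need not be the floor. *)
Lemma rich_number_block (l a : nat) : (a < b ^ l)%N ->
  exists i k : nat,
    a%:R <= (rich_number * b%:R ^+ i - k%:R) * b%:R ^+ l <= a%:R + 1.
Proof.
move=> al; pose n := pickle (l, a).
exists (rich_prefix n).1, (rich_prefix n).2.
have := rich_number_itv n.+1; rewrite /lo /hi /= /n pickleK /=.
case: (rich_prefix _) => N p /=.
rewrite modn_small// ler_pdivrMr// ler_pdivlMr// exprD mulrA.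
set z := rich_number * _; rewrite !natrD !natrM !natrX mulrBl.
by lra.
Qed.

Lemma mul_mod1_rich_number_dense (u v : R) : 0 <= u -> u < v -> v <= 1 ->
  exists2 y, mul_mod1 rich_number (powers b) y & u < y < v.
Proof.
move=> u0 uv v1.
(* With more than two cell lengths between [u] and [v], a whole closed cell of order [l] fits
   strictly between them. *)
have [l hl] : exists l, 2 < (v - u) * b%:R ^+ l.
  exists (Num.bound (2 / (v - u))).
  rewrite mulrC -ltr_pdivrMr ?subr_gt0//.
  have := @upper_nthrootP R (2 / (v - u)) _ (leqnn _); move=> /lt_le_trans; apply.
  by apply: lerXn2r; rewrite ?nnegrE ?ler0n// ler_nat.
have B0 := bX_gt0 l; set B := b%:R ^+ l in hl B0 *.
pose a := (Num.truncn (u * B)).+1.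
have ua : u * B < a%:R <= u * B + 1.
  have /andP[h1 h2] := @truncn_itv R (u * B) (mulr_ge0 u0 (ltW B0)).
  by rewrite /a h2/= -addn1 natrD lerD2r.
have av : a%:R + 1 < v * B by lra.
have al : (a < b ^ l)%N.
  rewrite -(ltr_nat R) natrX -/B.
  have : v * B <= B by rewrite ler_piMl// ltW.
  lra.
have [i [k /andP[h1 h2]]] := rich_number_block al.
rewrite -/B in h1 h2.
set y := _ - _ in h1 h2.
have uy : u < y by rewrite -(ltr_pM2r B0); lra.
have yv : y < v by rewrite -(ltr_pM2r B0); lra.
exists y; last by rewrite uy.
exists (b ^ i)%N; first by exists i.
(* Now 0 <= u < y < v <= 1, so [k] is indeed the floor. *)
rewrite natrX /y; congr (_ - _); rewrite (@floor_def _ _ k%:Z)//.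
move: uy yv; rewrite intrD -!pmulrn /y => uy yv.
apply/andP; split; lra.
Qed.

End RichNumber.

(** For bounded [A]: finitely many accumulation points, none approached from above. The list [L] is
    fixed before [e]. *)
Definition left_condensed (R : realType) (A : set R) : Prop :=
  exists L : seq R, forall e, 0 < e ->
    finite_set [set a | A a /\ forall l, l \in L -> ~~ (l - e <= a < l)].

(** * Limits from below in well-ordered sets of reals *)

Section WellOrderedSet.
Variables (R : realType) (A : set R) (M : R).
Hypothesis A_wo : well_order (<=%O : rel A).
Hypothesis A_lt : forall a, A a -> a < M.

Lemma well_order_min (B : set R) : B `<=` A -> B !=set0 ->
  exists2 m, B m & forall y, B y -> m <= y.
Proof.
move=> BA [y By].
have [|z [[/set_mem Bz zmin] _]] := A_wo (A := [pred z : A | val z \in B]).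
  by exists (exist _ y (mem_set (BA _ By))); rewrite !inE.
exists (val z) => // t Bt; apply: (zmin (exist _ t (mem_set (BA _ Bt)))).
by rewrite !inE.
Qed.

(** The first accumulation point above [c] is the infimum of the [r] with infinitely many points in
    (c, r); the well-order forbids approaching it from above. *)
Lemma infinite_left_limit (c : R) : infinite_set (A `&` [set a | c < a]) ->
  exists l, [/\ c < l,
    forall r, r < l -> finite_set (A `&` [set a | c < a < r]) &
    forall r, r < l -> exists2 a, A a & r < a < l].
Proof.
move=> A_inf; pose S := [set r | infinite_set (A `&` [set a | c < a < r])].
have SM : S M.
  apply: sub_infinite_set A_inf => a [Aa /= ca]; split => //=.
  by rewrite ca A_lt.
have S_gt r : S r -> c < r.
  move=> Sr; rewrite ltNge; apply/negP => rc; apply: Sr.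
  apply: sub_finite_set (@finite_set0 R) => a [_ /= /andP[ca ar]].
  by have := lt_trans ca ar; rewrite ltNge rc.
have S_lb : has_lbound S by exists c => r /S_gt/ltW.
pose l := inf S.
have below r : r < l -> finite_set (A `&` [set a | c < a < r]).
  by move=> rl; apply: contrapT => Sr; have := ge_inf S_lb Sr; rewrite leNgt rl.
have above r : l < r -> S r.
  move=> lr; have [|s Ss sr] := inf_lt (S := S) _ lr; first by exists M.
  apply: sub_infinite_set Ss => a [Aa /= /andP[ca as_]]; split => //=.
  by rewrite ca (lt_trans as_).
(* If (c, l) held finitely many points, so would (c, m) for the least point [m] of [A] above [l],
   although m > inf S. *)
have l_inf : S l.
  move=> l_fin; have fin1 : finite_set ((A `&` [set a | c < a < l]) `|` [set l]).
    by rewrite finite_setU.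
  have [||m [Am lm] m_min] := @well_order_min (A `&` [set a | l < a]).
  - by move=> a [].
  - apply: contrapT => /nonemptyPn A0; apply: A_inf.
    apply: sub_finite_set fin1 => a [Aa /= ca].
    have [al|la|->] := ltgtP a l; [left|exfalso|by right].
      by split => //=; rewrite ca ?al.
    by have : (A `&` [set a | l < a]) a by []; rewrite A0.
  apply: (above _ lm); apply: sub_finite_set fin1 => a [Aa /= /andP[ca am]].
  have [al|la|->] := ltgtP a l; [left|exfalso|by right].
    by split => //=; rewrite ca ?al.
  by have := m_min a (conj Aa la); rewrite leNgt am.
exists l; split => [||r rl]; [exact: S_gt|exact: below|].
apply: contrapT => no; apply: l_inf.
have : finite_set ((A `&` [set a | c < a < r]) `|` [set r]).
  by rewrite finite_setU; split => //; exact: below.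
apply: sub_finite_set => a [Aa /= /andP[ca al]].
have [ar|ra|->] := ltgtP a r; [left|exfalso|by right].
  by split => //=; rewrite ca ?ar.
by apply: no; exists a => //; rewrite ra.
Qed.

(** Take the first left limit [l] above [c]: if a list [L] worked beyond [l], then [l :: L] would
    work beyond [c], as only finitely many points lie in (c, l - e). *)
Lemma not_left_condensed_next (c : R) :
  ~ left_condensed (A `&` [set a | c < a]) ->
  exists l, [/\ c < l, ~ left_condensed (A `&` [set a | l < a]) &
    forall r, r < l -> exists2 a, A a & r < a < l].
Proof.
move=> nA; have /infinite_left_limit[l [cl fin lim]] :
    infinite_set (A `&` [set a | c < a]).
  move=> Afin; apply: nA; exists [::] => e e0.
  by apply: sub_finite_set Afin => a [].
exists l; split => // -[L LP]; apply: nA; exists (l :: L) => e e0.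
have : finite_set ((A `&` [set a | c < a < l - e]) `|` [set l] `|`
    [set a | (A `&` [set a | l < a]) a /\
             forall l, l \in L -> ~~ (l - e <= a < l)]).
  by rewrite !finite_setU; do !split => //; [apply: fin; rewrite gtrBl|exact: LP].
apply: sub_finite_set => a [[Aa /= ca] aL].
have [al|la|->] := ltgtP a l; [left; left|right|by left; right].
  have := aL l (mem_head _ _); rewrite ?al andbT -ltNge => ale.
  by split => //=; rewrite ca ?ale.
by split => // l' l'L; apply: aL; rewrite in_cons l'L orbT.
Qed.

(** Iterating the previous lemma gives limits l 0 < l 1 < ..., and an increasing sequence of [A]
    between any two consecutive ones; together these have type omega ^ 2. *)
Lemma omega2_le_not_left_condensed (c : R) : (forall a, A a -> c < a) ->
  ~ left_condensed A -> otype_le (nat *l nat)%type A.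
Proof.
move=> A_gt nA.
have /choice[next nextP] : forall c, exists l,
    ~ left_condensed (A `&` [set a | c < a]) ->
    [/\ c < l, ~ left_condensed (A `&` [set a | l < a]) &
      forall r, r < l -> exists2 a, A a & r < a < l].
  move=> c'; have [h|/not_left_condensed_next[l hl]] :=
    (* The default 0 is never met along the iteration, by [nAl] below. *)
    pselect (left_condensed (A `&` [set a | c' < a])); first by exists 0.
  by exists l.
pose l n := iter n next c.
have nAl n : ~ left_condensed (A `&` [set a | l n < a]).
  elim: n => [|n /nextP[]//]; rewrite (_ : _ `&` _ = A)//.
  apply/seteqP; split => [a []//|a Aa]; split => //; exact: A_gt.
have l_lt n : l n < l n.+1 by have [] := nextP _ (nAl n).
have l_lim n r : r < l n.+1 -> exists2 a, A a & r < a < l n.+1.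
  by have [_ _] := nextP _ (nAl n); apply.
have /choice[pick pickP] : forall p : nat * R, exists a,
    p.2 < l p.1.+1 -> A a /\ p.2 < a < l p.1.+1.
  move=> [n r]; have [/l_lim[a Aa ha]|h] := pselect (r < l n.+1).
    by exists a.
  by exists 0 => /h.
(* With [k.+1] rather than [k], the sequence starts at a point of [A] above [l n], not at [l n]
   itself. *)
pose a n k := iter k.+1 (fun r => pick (n, r)) (l n).
have aP n k : [/\ A (a n k), l n < a n k, a n k < l n.+1 & a n k < a n k.+1].
  have a_lt j : A (a n j) /\ l n < a n j < l n.+1.
    elim: j => [|j [_ /andP[lj jl]]]; first exact: (pickP (n, l n) (l_lt n)).
    have [Aj /andP[jj jl']] := pickP (n, a n j) jl.
    by split => //; apply/andP; split; [exact: lt_trans jj|exact: jl'].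
  have [Ak /andP[lk kl]] := a_lt k; split => //.
  by have [_ /andP[]] := pickP (n, a n k) kl.
apply: (otype_le_set (g := fun p : nat *l nat => a p.1 p.2)) => [p|].
  by have [] := aP p.1 p.2.
move=> [n k] [m j] /=; rewrite ltEprodlexi /= => /andP[nm nmkj].
have [nm'|mn|nm'] := ltngtP n m.
- have l_mono : {homo l : i j / (i <= j)%N >-> i <= j}.
    by apply: homo_leq => [//|? ? ?|i]; [exact: le_trans|exact: ltW].
  have [_ _ h _] := aP n k; have [_ h' _ _] := aP m j.
  by apply: lt_trans h (le_lt_trans _ h'); exact: l_mono.
- by move: nm; rewrite leEnat leqNgt mn.
- subst m; move: nmkj; rewrite lexx /= ltEnat => kj.
  apply: (homo_ltn (r := fun x y : R => x < y)) kj => [x y z|i].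
    exact: lt_trans.
  by have [] := aP n i.
Qed.

End WellOrderedSet.

(** A repeated value makes the orbit eventually periodic, hence finite. *)
Lemma iter_inj_infinite_range (T : Type) (f : T -> T) (x : T) :
  infinite_set (range (fun n => iter n f x)) -> injective (fun n => iter n f x).
Proof.
move=> inf_range.
have aux i j : (i < j)%N -> iter i f x <> iter j f x.
  move=> ij eq_ij; apply: inf_range.
  apply: sub_finite_set (finite_image (fun n => iter n f x) (finite_II j)).
  move=> _ [n _ <-]; elim/ltn_ind: n => n IH.
  have [nj|jn] := ltnP n j; first by exists n.
  have -> : iter n f x = iter (n - j + i) f x.
    by rewrite iterD eq_ij -iterD subnK.
  by apply: IH; rewrite -[ltnRHS](subnK jn) ltn_add2l.
move=> i j eq_ij; have [/aux[]//|/aux/(_ (esym eq_ij))[]|//] := ltngtP i j.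
Qed.

Lemma finite_nat_ubound (A : set nat) : finite_set A ->
  exists N, forall n, (N <= n)%N -> ~ A n.
Proof.
move=> /finite_seqP[s ->]; exists (\max_(i <- s) i).+1 => n + /= ns.
by rewrite ltnNge (leq_bigmax_seq (F := fun i => i) n ns).
Qed.

(** Serves to turn an approximate equality among finitely many candidates into an exact one. *)
Lemma seq_norm_gap (R : realDomainType) (s : seq R) :
  exists2 e : R, 0 < e & forall p, p \in s -> `|p| < e -> p = 0.
Proof.
elim: s => [|q s [e e0 IH]]; first by exists 1.
have [->|q0] := eqVneq q 0.
  by exists e => // p; rewrite in_cons => /predU1P[->//|/IH].
exists (Num.min e `|q|); first by rewrite lt_min e0 normr_gt0.
move=> p; rewrite in_cons lt_min => /predU1P[->|/IH h] /andP[].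
  by rewrite ltxx.
by move=> /h.
Qed.

(** * Orbits under multiplication by [b] modulo 1 *)

Section ExpandingMap.
Variables (R : realType) (b : nat).
Hypothesis b_gt1 : (1 < b)%N.

Definition frac (y : R) : R := y - (Num.floor y)%:~R.

Lemma frac_itv y : 0 <= frac y < 1.
Proof.
have /andP[h1 h2] := floor_itv y; move: h2; rewrite intrD /frac => h2.
by apply/andP; split; lra.
Qed.

Lemma frac_addz y (m : int) : frac (y + m%:~R) = frac y.
Proof.
by rewrite /frac floorDrz ?intr_int// intrKfloor intrD; ring.
Qed.

Lemma frac_mul_powers x n :
  frac (x * (b ^ n)%:R) = iter n (fun y => frac (b%:R * y)) (frac x).
Proof.
elim: n => [|n IH] /=; first by rewrite expn0 mulr1.
rewrite -IH expnS natrM -[RHS](frac_addz _ (b%:Z * Num.floor (x * (b ^ n)%:R))).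
congr frac; rewrite /frac intrM -pmulrn; ring.
Qed.

Lemma mul_mod1_powers x : mul_mod1 x (powers b) =
  range (fun n => iter n (fun y => frac (b%:R * y)) (frac x)).
Proof.
apply/seteqP; split => [_ [_ [n _ <-] <-]|_ [n _ <-]].
  by exists n => //; rewrite -frac_mul_powers.
by exists (b ^ n)%N; [exists n|rewrite -[RHS]frac_mul_powers].
Qed.

(* If almost all points of the orbit lie at distance at most [e] below a point
   of the finite set [L], with [e] small with respect to the gaps between the
   images of [L] and [L] itself, then this distance is multiplied by exactly
   [b] at each step, so it cannot stay bounded. *)
Lemma orbit_not_left_condensed x :
  let X n := iter n (fun y => frac (b%:R * y)) (frac x) in
  infinite_set (range X) -> ~ left_condensed (range X).
Proof.
move=> X X_inf [L LP]; have X_inj := iter_inj_infinite_range X_inf.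
have b1 : 1 < b%:R :> R by rewrite ltr1n.
have b0 : 0 < b%:R :> R by rewrite ltr0n ltnW.
have X_itv n : 0 <= X n < 1 by case: n => [|n]; exact: frac_itv.
(* The candidates are b * y - z - k, with [k] the digit removed by [frac], which is below [b]. *)
have [e e0 eP] := seq_norm_gap [seq p - k%:R |
  p <- [seq b%:R * y - z | y <- L, z <- L], k <- iota 0 b].
have eb0 : 0 < e / b%:R by rewrite divr_gt0.
have [N NP] : exists N, forall n, (N <= n)%N ->
    exists y, y \in L /\ y - e / b%:R <= X n < y.
  have /finite_nat_ubound[N NP] :=
    finite_preimage (f := X) (in2W X_inj) (LP _ eb0).
  exists N => n /NP noP; apply: contrapT => no; apply: noP; split.
    by exists n.
  by move=> l lL; apply/negP => h; apply: no; exists l.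
have {NP}/choice[y yP] n : exists y, y \in L /\ y - e / b%:R <= X (N + n)%N < y.
  by apply: NP; exact: leq_addr.
pose d n := y n - X (N + n)%N.
have d_itv n : 0 < d n <= e / b%:R.
  by have [_ /andP[h1 h2]] := yP n; apply/andP; rewrite /d; split; lra.
have dS n : d n.+1 = b%:R * d n.
  have /andP[d0 de] := d_itv n; have /andP[d0' de'] := d_itv n.+1.
  have [yL _] := yP n; have [yL' _] := yP n.+1.
  have /andP[Xn0 Xn1] := X_itv (N + n)%N.
  pose k := Num.floor (b%:R * X (N + n)%N).
  have k0 : 0 <= k by rewrite floor_ge0 mulr_ge0// ltW.
  have kb : k < b.
    rewrite -(ltr_int R); apply: le_lt_trans (floor_le _) _.
    by rewrite -pmulrn gtr_pMr.
  have XS : X (N + n.+1)%N = b%:R * X (N + n)%N - `|k|%N%:R.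
    by rewrite addnS [LHS]/= /frac -/(X _) -/k -[in LHS](gez0_abs k0).
  have : b%:R * y n - y n.+1 - `|k|%N%:R = 0.
    apply: eP.
      apply: allpairs_f; first exact: allpairs_f.
      by rewrite mem_iota /= add0n -ltz_nat gez0_abs.
    (* Both terms are positive and at most [e], so their difference is smaller than [e] in absolute
       value. *)
    rewrite (_ : _ - _ = b%:R * d n - d n.+1); last by rewrite /d XS; ring.
    have : e / b%:R <= e by rewrite ler_pdivrMr// ler_peMr// ltW.
    have : b%:R * d n <= e by rewrite mulrC -ler_pdivlMr.
    have : 0 < b%:R * d n by rewrite mulr_gt0.
    by rewrite ltr_norml => *; apply/andP; split; lra.
  by rewrite /d XS => h; lra.
have dE n : d n = b%:R ^+ n * d 0%N.
  by elim: n => [|n IH]; rewrite ?mul1r// dS IH exprS mulrA.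
have /andP[d0 _] := d_itv 0%N.
pose n := Num.bound (e / b%:R / d 0%N).
have /andP[_] := d_itv n; apply/negP; rewrite -ltNge dE -ltr_pdivrMr//.
apply: lt_le_trans (upper_nthrootP (leqnn _)) _.
by apply: lerXn2r; rewrite ?nnegrE ?ler0n// ler_nat.
Qed.

End ExpandingMap.

Theorem theorem3 (R : realType) (b : nat) (hb : (2 <= b)%N) :
  (forall (d : Order.disp_t) (T : orderType d),
     countable [set: T] -> well_order (<=%O : rel T) ->
     exists x : R, otype_le T (mul_mod1 x (powers b)))
  /\
  ~ (exists x : R,
       [/\ well_order (<=%O : rel (mul_mod1 x (powers b))),
           otype_le nat (mul_mod1 x (powers b)) &
           otype_lt (mul_mod1 x (powers b)) (nat *l nat)%type]).
Proof.
split => [d T T_countable _|[x [A_wo omega_A [_ A_omega2]]]].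
  exists (rich_number R b); apply: countable_otype_le_dense => // u v.
  exact: mul_mod1_rich_number_dense.
apply: A_omega2.
have A_itv a : mul_mod1 x (powers b) a -> 0 <= a < 1.
  by case=> s _ <-; exact: frac_itv.
(* The lower bound must be strict and the orbit may contain 0, whence -1. *)
apply: (@omega2_le_not_left_condensed _ _ 1 A_wo _ (-1)).
- by move=> a /A_itv/andP[].
- by move=> a /A_itv/andP[a0 _]; lra.
have A_inf : infinite_set (mul_mod1 x (powers b)).
  have [f f_mono] := omega_A; move=> A_fin; apply: infinite_nat.
  have f_inj : injective (val \o f) := inj_comp val_inj (inc_inj f_mono).
  apply: sub_finite_set (finite_preimage (in2W f_inj) A_fin) => n _ /=.
  exact: set_mem (valP (f n)).
by move: A_inf; rewrite mul_mod1_powers; exact: orbit_not_left_condensed.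
Qed.
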